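(* Let $\mathcal{S}_{n,L,\lambda,\sigma,\tau,z}$ be the colored stochastic symplectic ice with $\sigma,\tau\in B_n$, $\lambda=(\lambda_1\ge\dots\ge\lambda_n\ge0)$ a partition and $L\ge\lambda_1+n$. Assume that $1\le i\le n-1$ and $\sigma(i+1)>\sigma(i)$. Let $s_i$ be the transposition $(i,i+1)$ in $B_n$, and let $s_iz$ be the vector obtained from $z=(z_1,\dots,z_n)$ by interchanging $z_i$ and $z_{i+1}$. Then $$q^{1_{\sigma(i+1)>0}-1_{\sigma(i)>0}}\,Z(\mathcal{S}_{n,L,\lambda,\sigma s_i,\tau,z})=-A(q,z,i)\,Z(\mathcal{S}_{n,L,\lambda,\sigma,\tau,z})+B(q,z,i)\,Z(\mathcal{S}_{n,L,\lambda,\sigma,\tau,s_iz}),$$ where $$A(q,z,i)=\frac{(1-z_{i+1})(1-qz_i)}{z_{i+1}-z_i},\qquad B(q,z,i)=\frac{1-(q+1)z_i+qz_iz_{i+1}}{z_{i+1}-z_i}.$$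
   Context: Parameters: $q,z_1,\dots,z_n$ are indeterminates (equivalently, generic complex numbers for which every denominator is nonzero); $z_i'=q+1-\frac1{z_i}$. $1_{E}$ is the indicator of the condition $E$. Colors and group. Labels are $[\pm n]\cup\{0\}$, with $[\pm n]=\{\bar n,\dots,\bar1,1,\dots,n\}$, $\overline{\bar k}=k$ ($\bar k$ is also thought of as $-k$), ordered by $\bar n<\dots<\bar1<0<1<\dots<n$. The colors are $c_\alpha$, $\alpha\in[\pm n]$, and $c_0:=+$. $B_n$ is the hyperoctahedral group of permutations $\sigma$ of $[\pm n]$ with $\sigma(\bar k)=\overline{\sigma(k)}$; products are composed right to left, $(\sigma\tau)(k)=\sigma(\tau(k))$. The element $s_i$ exchanges $i$ with $i+1$ and $\bar i$ with $\overline{i+1}$. Vertex weights, as functions of the colors (left, top, right, bottom); unlisted configurations have weight $0$. For every color $x$, $(x,x,x,x)\mapsto1$, and for all labels $\alpha<\beta$: - colored stochastic $\Gamma$ vertex with spectral parameter $z_i$: $(c_\alpha,c_\beta,c_\alpha,c_\beta)\mapsto z_i$, $(c_\beta,c_\alpha,c_\beta,c_\alpha)\mapsto qz_i$, $(c_\beta,c_\alpha,c_\alpha,c_\beta)\mapsto1-qz_i$, $(c_\alpha,c_\beta,c_\beta,c_\alpha)\mapsto1-z_i$. - colored stochastic $\Delta$ vertex with spectral parameter $z_i$: $(c_\alpha,c_\beta,c_\alpha,c_\beta)\mapsto z_i'$, $(c_\beta,c_\alpha,c_\beta,c_\alpha)\mapsto\frac1qz_i'$, $(c_\beta,c_\beta,c_\alpha,c_\alpha)\mapsto1-z_i'$,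 $(c_\alpha,c_\alpha,c_\beta,c_\beta)\mapsto1-\frac1qz_i'$. Model $\mathcal{S}_{n,L,\lambda,\sigma,\tau,z}$. A rectangular lattice with $2n$ rows numbered $1,\dots,2n$ from bottom to top and $L$ columns numbered $1,\dots,L$ from right to left; for $1\le i\le n$ row $2i-1$ consists of colored stochastic $\Delta$ vertices and row $2i$ of colored stochastic $\Gamma$ vertices, all with spectral parameter $z_i$. Boundary conditions: the left edge of row $2i$ carries $c_{\sigma(i)}$ and the left edge of row $2i-1$ carries $+$; all top edges carry $+$; the bottom edge in column $\lambda_i+n+1-i$ carries $c_{\tau(i)}$ for $1\le i\le n$, and other bottom edges carry $+$. On the right, rows $2i$ and $2i-1$ are joined by a cap with weight $K(x,y)$, $x$ and $y$ being the right-most colors of rows $2i$ and $2i-1$: $K(+,+)=1$, $K(c_\alpha,c_{\bar\alpha})=1$ for all $\alpha\in[\pm n]$, and $K=0$ otherwise. The partition function $Z$ is the sum, over all assignments of colors to the edges compatible with the boundary conditions, of the product of all vertex and cap weights. *)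

(* Defs.v *)
From HB Require Import structures.
From mathcomp Require Import all_boot all_order all_algebra all_fingroup.

Set Implicit Arguments.
Unset Strict Implicit.
Unset Printing Implicit Defensive.

Import GRing.Theory.
Local Open Scope ring_scope.

(* The label a in {-n, ..., n} is the ordinal n + a, so that the order of the
   labels is the order of the ordinals.  Labels also serve as colors, the color
   + being the one with label 0. *)
Definition label (n : nat) := 'I_(n.*2.+1).

Definition plus (n : nat) : label n := inord n.

(* Indices are 0-based: k : 'I_n stands for the index k + 1, so [pos k] is the
   positive label k + 1. *)
Definition pos (n : nat) (k : 'I_n) : label n := inord (n + k.+1)%N.

Definition bar (n : nat) (a : label n) : label n := rev_ord a.

(* A permutation of the nonzero labels is a permutation of all labels which
   fixes the label 0. *)
Definition hyperoct (n : nat) : {set {perm label n}} :=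
  [set s | perm_on [set~ plus n] s & [forall a, s (bar a) == bar (s a)]].

(* Product composed right to left, (s t)(k) = s (t k); the product of
   permutations in MathComp composes left to right. *)
Definition mulB (n : nat) (s t : {perm label n}) : {perm label n} := (t * s)%g.

Definition transB (n : nat) (i j : 'I_n) : {perm label n} :=
  (tperm (pos i) (pos j) * tperm (bar (pos i)) (bar (pos j)))%g.

Section Weights.
Variables (F : fieldType) (n : nat).
Implicit Types (q x : F) (l t r b : label n).

(* The colors around a vertex are given in the order left, top, right, bottom. *)
Definition gamma_weight q x l t r b : F :=
  if [&& l == t, t == r & r == b] then 1
  else if (l == r) && (t == b) then if (l < t)%N then x else q * x
  else if (l == b) && (t == r) then if (l < t)%N then 1 - x else 1 - q * x
  else 0.

Definition delta_param q x : F := q + 1 - x^-1.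

Definition delta_weight q x l t r b : F :=
  let x' := delta_param q x in
  if [&& l == t, t == r & r == b] then 1
  else if (l == r) && (t == b) then if (l < t)%N then x' else q^-1 * x'
  else if (l == t) && (r == b) then if (l < r)%N then 1 - q^-1 * x' else 1 - x'
  else 0.

(* [u] is the right-most color of the Gamma row, [v] that of the Delta row. *)
Definition cap_weight (u v : label n) : F :=
  if (u == plus n) && (v == plus n) then 1
  else if (u != plus n) && (v == bar u) then 1
  else 0.

End Weights.

(* For 0-based k : 'I_n, the row [(k, false)] is the (2k+1)-st row from the
   bottom (Delta) and [(k, true)] the (2k+2)-nd (Gamma); [level] is the number
   of rows below.  The 0-based c : 'I_L is the column numbered c + 1 from right
   to left. *)
Definition ice_row (n : nat) := ('I_n * bool)%type.

Definition level (n : nat) (r : ice_row n) : nat := r.1.*2 + r.2.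

(* Colors of the horizontal edges: [(r, e)] is the edge of row r with e columns
   to its right, so e = 0 is the right-most edge and e = L the left-most one. *)
Definition hcolors (n L : nat) := {ffun ice_row n * 'I_L.+1 -> label n}.

(* Colors of the vertical edges: [(v, c)] is the edge of column c with v rows
   below it. *)
Definition vcolors (n L : nat) := {ffun 'I_(n.*2.+1) * 'I_L -> label n}.

Definition state (n L : nat) := (hcolors n L * vcolors n L)%type.

Section Model.
Variables (F : fieldType) (n L : nat) (lam : n.-tuple nat).
Variables (sigma tau : {perm label n}) (q : F) (z : 'I_n -> F).
Implicit Types (s : state n L) (r : ice_row n) (c : 'I_L).

Definition left_edge s r c : label n := s.1 (r, inord c.+1).
Definition right_edge s r c : label n := s.1 (r, inord c).
Definition bottom_edge s r c : label n := s.2 (inord (level r), c).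
Definition top_edge s r c : label n := s.2 (inord (level r).+1, c).

(* With k = i - 1, the column number lambda_i + n + 1 - i is
   lambda_i + (n - k). *)
Definition bottom_color c : label n :=
  if [pick k : 'I_n | c.+1 == tnth lam k + (n - k)]%N is Some k
  then tau (pos k) else plus n.

Definition compatible s : bool :=
  [&& [forall k : 'I_n, s.1 ((k, true), ord_max) == sigma (pos k)],
      [forall k : 'I_n, s.1 ((k, false), ord_max) == plus n],
      [forall c : 'I_L, s.2 (ord_max, c) == plus n]
    & [forall c : 'I_L, s.2 (ord0, c) == bottom_color c]].

Definition vertex_weight s r c : F :=
  (if r.2 then @gamma_weight else @delta_weight) F n q (z r.1)
    (left_edge s r c) (top_edge s r c) (right_edge s r c) (bottom_edge s r c).

Definition state_weight s : F :=
  (\prod_(r : ice_row n) \prod_(c < L) vertex_weight s r c) *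
  \prod_(k < n) cap_weight F (s.1 ((k, true), ord0)) (s.1 ((k, false), ord0)).

Definition partition_function : F :=
  \sum_(s : state n L | compatible s) state_weight s.

End Model.

(* Main.v *)
Require Import Defs.
From mathcomp Require Import all_boot all_order all_algebra all_fingroup.
From mathcomp Require Import zify ring.

(* The four rows of the parameters x = z_i and y = z_{i+1} form, as matrices
   acting on the vertical edges, a product D_x D_y of double rows, where
   D_x(u, d) = sum_g S_x(d, bar g) T_x(u, g) with T the Gamma row and S the Delta
   row.  The rows satisfy Yang-Baxter relations Gamma-Gamma, Delta-Delta and
   Delta-Gamma, and the caps are compatible with the R-matrices, so that the
   double rows satisfy Sklyanin's reflection equation.  Only the Delta-Gamma
   R-matrix with the Delta line above the Gamma line on its right is needed; the
   one for the opposite order depends on the number of colors.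
   For the boundary colors (sigma(i+1), sigma(i), +, +) only three terms of this
   equation survive.  Each of them contains the weight of a color u crossing +,
   which is N if u < 0 and q N if u > 0 for one polynomial N in q, x and y.
   Dividing by N gives the recursion. *)

Set Implicit Arguments.
Unset Strict Implicit.
Unset Printing Implicit Defensive.

Import GRing.Theory.
Local Open Scope ring_scope.

(** * Vertex weights and R-matrices *)

Section Vertices.
Variables (R : comNzRingType) (n : nat).
Implicit Types (q x y : R) (a b c d l t r u v : label n) (A B : label n -> label n -> R).

Definition cmp u v (e1 e2 e0 : R) : R :=
  if (u < v)%N then e1 else if (v < u)%N then e2 else e0.

(* Two lines with incoming colors u and v leave with colors r and t: with weight
   A each line keeps its color, with weight B the colors are exchanged. *)
Definition cross A B u v r t : R :=
  (r == u)%:R * (t == v)%:R * A u v + (r == v)%:R * (t == u)%:R * B u v.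

Definition gammaw q x l t r b : R :=
  cross (fun u v => cmp u v x (q * x) 1)
        (fun u v => cmp u v (1 - x) (1 - q * x) 0) l t r b.

(* This is q x times the Delta weight: clearing the denominators makes every
   weight polynomial in q and x, hence meaningful over any commutative ring. *)
Definition deltaw q x l t r b : R :=
  cross (fun u v => cmp u v (q * ((q + 1) * x - 1)) ((q + 1) * x - 1) (q * x))
        (fun u v => cmp u v (q * (1 - q * x)) (1 - x) 0) r t l b.

(* In an R-matrix, a and b are the colors of the upper and lower left edges, c
   and d those of the upper and lower right edges.  The lines on the right are,
   from top to bottom, Gamma(y) and Gamma(x) for Rgamma, Delta(x) and Delta(y)
   for Rdelta, and a Delta line and a Gamma line for Rmixed.  Colors travel to
   the right on Gamma lines and to the left on Delta lines, which determines the
   incoming edges. *)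
Definition Rgamma q x y a b c d : R :=
  cross (fun u v => cmp u v (q * (y - x)) (y - x) (1 - (q + 1) * x + q * x * y))
        (fun u v => cmp u v ((1 - x) * (1 - q * y)) ((1 - q * x) * (1 - y)) 0)
        a b d c.

Definition Rdelta q x y a b c d : R :=
  cross (fun u v => cmp u v (q * (y - x)) (y - x) (1 - (q + 1) * x + q * x * y))
        (fun u v => cmp u v ((1 - x) * (1 - q * y)) ((1 - q * x) * (1 - y)) 0)
        d c a b.

(** This is the polynomial N. It is symmetric in x and y and its constant term is 1. *)
Definition mixed q x y : R := (1 + q + q ^+ 2) * (x * y) - (1 + q) * (x + y) + 1.

Definition Rmixed q x y a b c d : R :=
  cross (fun u v => cmp u v (mixed q x y) (q * mixed q x y)
                          (q * ((1 + q) * (x * y) - x - y)))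
        (fun u v => cmp u v (- ((1 - x) * (1 - y)))
                          (- (q * ((1 - q * x) * (1 - q * y)))) 0)
        a c d b.

Lemma sum_deltaZ (T : finType) (V : lmodType R) (w : T) (F : T -> V) :
  \sum_t (t == w)%:R *: F t = F w.
Proof.
rewrite (bigD1 w) //= eqxx scale1r big1 ?addr0 // => t /negPf ->.
by rewrite scale0r.
Qed.

Lemma sum_delta (T : finType) (u : T) (F : T -> R) :
  \sum_x (x == u)%:R * F x = F u.
Proof. exact: (sum_deltaZ (V := R^o)). Qed.

(** Once the incoming colors are known, a crossing has only two possible outcomes. This and the next
    lemmas remove all sums over intermediate colors from the Yang-Baxter equations. *)
Lemma sum_crossZ (V : lmodType R) A B u v (F : label n -> label n -> V) :
  \sum_r \sum_t cross A B u v r t *: F r t = A u v *: F u v + B u v *: F v u.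
Proof.
under eq_bigr => r _.
  rewrite (eq_bigr (fun t => (t == v)%:R *: ((r == u)%:R *: (A u v *: F r t))
     + (t == u)%:R *: ((r == v)%:R *: (B u v *: F r t)))); last first.
    by move=> t _; rewrite /cross scalerDl !scalerA; congr (_ *: _ + _ *: _); ring.
  rewrite big_split /= !sum_deltaZ.
  over.
by rewrite big_split /= !sum_deltaZ.
Qed.

Lemma sum_cross A B u v (F : label n -> label n -> R) :
  \sum_r \sum_t cross A B u v r t * F r t = A u v * F u v + B u v * F v u.
Proof. exact: (sum_crossZ (V := R^o)). Qed.

Lemma sum_cross1 A B u v r (F : label n -> R) :
  \sum_t cross A B u v r t * F t
  = (r == u)%:R * A u v * F v + (r == v)%:R * B u v * F u.
Proof.
rewrite /cross (eq_bigr (fun t => (t == v)%:R * ((r == u)%:R * A u v * F t)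
     + (t == u)%:R * ((r == v)%:R * B u v * F t))); last by move=> t _; ring.
by rewrite big_split /= !sum_delta.
Qed.

Lemma sum_cross2 A B u v t (F : label n -> R) :
  \sum_r cross A B u v r t * F r
  = (t == v)%:R * A u v * F u + (t == u)%:R * B u v * F v.
Proof.
rewrite /cross (eq_bigr (fun r => (r == u)%:R * ((t == v)%:R * A u v * F r)
     + (r == v)%:R * ((t == u)%:R * B u v * F r))); last by move=> r _; ring.
by rewrite big_split /= !sum_delta.
Qed.

(** The R-matrix X moves from the left of a column to its right, and the rows W1 (above) and W2
    (below) trade places. The outer vertical colors are t on top and s at the bottom. *)
Definition ybe (V : finType) (X : label n -> label n -> label n -> label n -> R)
    (W1 W2 : label n -> V -> label n -> V -> R) : Prop :=
  forall a b c d (t s : V),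
  \sum_a' \sum_b' X a b a' b' * (\sum_m W1 a' t c m * W2 b' m d s)
  = \sum_a' \sum_b' (\sum_m W2 a t a' m * W1 b m b' s) * X a' b' c d.

End Vertices.

(** * Yang-Baxter equations at one vertex, and reflection at the caps *)

Ltac resolve_lt := repeat match goal with
  | |- context [(?x < ?y)%N] =>
     first [ (have -> : (x < y)%N = true by lia)
           | (have -> : (x < y)%N = false by lia) ]
  end.

(** Three colors enter the diagram of a Yang-Baxter equation, and the weights depend only on their
    relative order. Each order leaves a polynomial identity, with delta symbols for the outgoing
    colors. *)
Ltac compare_three a b c :=
  rewrite /cmp;
  case: (ltngtP a b) => [?|?|/val_inj ?]; subst;
  (try (case: (ltngtP b c) => [?|?|/val_inj ?]; subst));
  (try (case: (ltngtP a c) => [?|?|/val_inj ?]; subst));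
  try (exfalso; lia); resolve_lt; ring.

Section YBE.
Variables (R : comNzRingType) (n : nat) (q x y : R).

(** A crossing can be summed only when its incoming colors are known, so the sums must follow the
    direction of travel: P comes first, and then Q here or X in the variant below. *)
Lemma sum_vertical_first (I J K : finType) (X : I -> J -> R) (P : I -> K -> R)
    (Q : J -> K -> R) :
  \sum_i \sum_j X i j * (\sum_k P i k * Q j k)
  = \sum_i \sum_k P i k * (\sum_j Q j k * X i j).
Proof.
apply: eq_bigr => i _.
under eq_bigr do rewrite mulr_sumr.
rewrite exchange_big /=; apply: eq_bigr => k _; rewrite mulr_sumr.
by apply: eq_bigr => j _; ring.
Qed.

Lemma sum_vertical_first' (I J K : finType) (X : I -> J -> R) (P : I -> K -> R)
    (Q : J -> K -> R) :
  \sum_i \sum_j X i j * (\sum_k P i k * Q j k)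
  = \sum_i \sum_k P i k * (\sum_j X i j * Q j k).
Proof.
rewrite sum_vertical_first; apply: eq_bigr => i _; apply: eq_bigr => k _.
by congr (_ * _); apply: eq_bigr => j _; rewrite mulrC.
Qed.

Lemma ybe_gamma : ybe (Rgamma q x y) (@gammaw R n q y) (gammaw q x).
Proof.
move=> a b c d t s; rewrite exchange_big /=.
rewrite {1}/Rgamma sum_cross /gammaw !sum_cross1.
under [RHS]eq_bigr do under eq_bigr do rewrite mulrC.
by rewrite sum_vertical_first sum_cross !sum_cross2 /Rgamma /cross; compare_three a b t.
Qed.

Lemma ybe_delta : ybe (Rdelta q x y) (@deltaw R n q x) (deltaw q y).
Proof.
move=> a b c d t s; rewrite sum_vertical_first /deltaw sum_cross !sum_cross2.
under [RHS]eq_bigr do under eq_bigr do rewrite mulrC.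
by rewrite /Rdelta sum_cross !sum_cross1 /cross; compare_three c d t.
Qed.

Lemma ybe_mixed : ybe (Rmixed q x y) (@deltaw R n q y) (gammaw q x).
Proof.
move=> a b c d t s; rewrite sum_vertical_first' /deltaw sum_cross.
rewrite /Rmixed !sum_cross2.
under [RHS]eq_bigr do under eq_bigr do rewrite mulrC.
rewrite sum_vertical_first' /gammaw sum_cross !sum_cross1 /cross.
by rewrite /mixed; compare_three a c t.
Qed.

Lemma mixedC : mixed q x y = mixed q y x.
Proof. rewrite /mixed; ring. Qed.

(** By this symmetry one R-matrix serves both for Delta(y) with Gamma(x) and for Delta(x) with
    Gamma(y), as the reflection equation requires. *)
Lemma RmixedC (a b c d : label n) : Rmixed q x y a b c d = Rmixed q y x a b c d.
Proof. by rewrite /Rmixed /cross /cmp mixedC; case: ifP => _; [|case: ifP => _]; ring. Qed.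

Lemma barK : involutive (@bar n).
Proof. exact: rev_ordK. Qed.

Lemma bar_eq (a b : label n) : (bar a == b) = (a == bar b).
Proof. by rewrite (can2_eq barK barK). Qed.

(** Since [bar] reverses the order of the labels, all comparisons reduce to those of a with b and of
    a with [bar b]. *)
Lemma cap_reflection (a b c d : label n) :
  \sum_r \sum_m Rgamma q x y a b r m * Rmixed q x y m c (bar r) (bar d)
  = \sum_m \sum_r Rdelta q x y c d m r * Rmixed q x y b m (bar a) (bar r).
Proof.
rewrite exchange_big /= {1}/Rgamma sum_cross.
under [RHS]eq_bigr do under eq_bigr do rewrite mulrC.
have -> : \sum_m \sum_r Rmixed q x y b m (bar a) (bar r) * Rdelta q x y c d m r
  = \sum_r \sum_m Rmixed q x y b m (bar a) r * Rdelta q x y c d m (bar r).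
  rewrite exchange_big /= (reindex_inj (inv_inj barK)) /=.
  by under eq_bigr do rewrite barK.
rewrite /Rmixed sum_cross /Rdelta /cross !(bar_eq d) !barK.
have lt_bar (u v : label n) : (bar u < bar v)%N = (v < u)%N.
  rewrite /bar /=; have := ltn_ord u; have := ltn_ord v; lia.
have lt_barr (u v : label n) : (u < bar v)%N = (v < bar u)%N by rewrite -[in LHS](barK u) lt_bar.
have lt_barl (u v : label n) : (bar u < v)%N = (bar v < u)%N by rewrite -[in LHS](barK v) lt_bar.
rewrite /cmp !lt_bar (lt_barr b) (lt_barl a) /mixed.
case: (ltngtP a b) => [_|_|/val_inj ->]; case: (ltngtP a (bar b)) => [_|_|/val_inj ab];
  by rewrite ?ab ?barK; ring.
Qed.
End YBE.

(** * Reflection equation *)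

Section Reflection.
Variables (R : comNzRingType) (n k : nat).
Implicit Types (X : label n -> label n -> label n -> label n -> R).
Implicit Types (W T S : label n -> label n -> 'M[R]_k).

(** The Yang-Baxter equation for whole rows, seen as matrices on the vertical edges. The left factor
    of a product is the lower row. *)
Definition exchange X W1 W2 : Prop := forall a b c d,
  \sum_r X a b r.1 r.2 *: (W2 r.2 d *m W1 r.1 c)
  = \sum_r X r.1 r.2 c d *: (W1 b r.2 *m W2 a r.1).

Definition double_row S T (u d : label n) : 'M[R]_k :=
  \sum_g S d (bar g) *m T u g.

(** On the left, RM passes through Tx and Sy, then RG through the two Gamma rows; on the right, RM
    passes through Ty and Sx, then RD through the two Delta rows. Either way the rows end in the
    order Sx, Sy, Ty, Tx from bottom to top, with the R-matrices between them and the caps, where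
    [refl] applies. *)
Lemma reflection_equation (RG RM RD : label n -> label n -> label n -> label n -> R)
    (Sx Tx Sy Ty : label n -> label n -> 'M[R]_k) (a b c d : label n) :
  exchange RG Ty Tx -> exchange RD Sx Sy ->
  exchange RM Sy Tx -> exchange RM Sx Ty ->
  (forall a b c d, \sum_r \sum_m RG a b r m * RM m c (bar r) (bar d)
     = \sum_m \sum_r RD c d m r * RM b m (bar a) (bar r)) ->
  \sum_r RG a b r.1 r.2 *: \sum_s RM r.2 c s.1 s.2 *:
     (double_row Sx Tx s.2 d *m double_row Sy Ty r.1 s.1)
  = \sum_r RD c d r.1 r.2 *: \sum_s RM b r.1 s.1 s.2 *:
     (double_row Sy Ty s.2 r.2 *m double_row Sx Tx a s.1).
Proof.
move=> exG exD exMyx exMxy refl.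
transitivity (\sum_h \sum_g \sum_(e : label n * label n)
   (\sum_r RG e.1 e.2 r.1 r.2 * RM r.2 g (bar r.1) (bar h)) *:
   (Sx d h *m Sy c g *m (Ty b e.2 *m Tx a e.1))).
  transitivity (\sum_h \sum_g Sx d (bar h) *m
    (\sum_r RG a b r.1 r.2 *:
      ((\sum_s RM r.2 c s.1 s.2 *: (Tx s.2 h *m Sy s.1 (bar g))) *m Ty r.1 g))).
    under eq_bigr => r _ do under eq_bigr => s _ do
      rewrite /double_row mulmx_suml scaler_sumr.
    under eq_bigr => r _ do rewrite exchange_big scaler_sumr.
    rewrite exchange_big /=; apply: eq_bigr => h _.
    under eq_bigr => r _ do under eq_bigr => s _ do
      rewrite mulmx_sumr scaler_sumr.
    under eq_bigr => r _ do rewrite exchange_big scaler_sumr.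
    rewrite exchange_big /=; apply: eq_bigr => g _.
    rewrite mulmx_sumr; apply: eq_bigr => r _.
    rewrite -scalemxAr mulmx_suml mulmx_sumr; congr (_ *: _).
    apply: eq_bigr => s _.
    by rewrite -scalemxAl -scalemxAr !mulmxA.
  (* From here on h is the color at the Delta end of its cap, so that RM receives [bar h] as in
     [refl]. *)
  rewrite (reindex_inj (inv_inj (@barK n))) /=; apply: eq_bigr => h _.
  rewrite barK.
  transitivity (\sum_g \sum_p RM p.1 p.2 (bar g) (bar h) *:
     (Sx d h *m Sy c p.2 *m
       \sum_r RG a b r.1 r.2 *: (Tx r.2 p.1 *m Ty r.1 g))).
    apply: eq_bigr => g _.
    under eq_bigr => r _ do rewrite exMyx mulmx_suml scaler_sumr.
    rewrite exchange_big mulmx_sumr /=; apply: eq_bigr => p _.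
    rewrite !mulmx_sumr scaler_sumr; apply: eq_bigr => r _.
    by rewrite -!scalemxAr -scalemxAl -scalemxAr !scalerA mulrC !mulmxA.
  rewrite pair_big_dep /=.
  transitivity (\sum_(gp : label n * (label n * label n)) \sum_e
     (RG e.1 e.2 gp.1 gp.2.1 * RM gp.2.1 gp.2.2 (bar gp.1) (bar h)) *:
       (Sx d h *m Sy c gp.2.2 *m (Ty b e.2 *m Tx a e.1))).
    apply: eq_bigr => -[g [p p']] _ /=.
    rewrite [X in _ *m X](exG a b g p) mulmx_sumr scaler_sumr.
    by apply: eq_bigr => e _; rewrite -scalemxAr scalerA mulrC.
  under [RHS]eq_bigr do under eq_bigr do rewrite scaler_suml.
  under [RHS]eq_bigr do rewrite exchange_big.
  rewrite [RHS]pair_big /=.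
  by rewrite (reindex (fun u => (u.2.1, (u.2.2, u.1)))) //;
    exists (fun u => (u.2.2, (u.1, u.2.1))) => -[? [? ?]].
(* The right side is now brought to the same form, with RD in place of RG. *)
symmetry.
transitivity (\sum_f \sum_g
    \sum_r RD c d r.1 r.2 *: (Sy r.2 (bar g) *m
      (\sum_s RM b r.1 s.1 s.2 *: (Ty s.2 g *m Sx s.1 (bar f))) *m Tx a f)).
  under eq_bigr => r _ do under eq_bigr => s _ do
    rewrite /double_row mulmx_sumr scaler_sumr.
  under eq_bigr => r _ do rewrite exchange_big scaler_sumr.
  rewrite exchange_big /=; apply: eq_bigr => f _.
  under eq_bigr => r _ do under eq_bigr => s _ do
    rewrite mulmx_suml scaler_sumr.
  under eq_bigr => r _ do rewrite exchange_big scaler_sumr.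
  rewrite exchange_big /=; apply: eq_bigr => g _.
  apply: eq_bigr => r _; congr (_ *: _).
  rewrite mulmx_sumr mulmx_suml; apply: eq_bigr => s _.
  by rewrite -scalemxAr -scalemxAl !mulmxA.
transitivity (\sum_f \sum_r \sum_p RM p.1 p.2 (bar f) (bar r) *:
    ((\sum_s RD c d s.1 s.2 *: (Sy s.2 r *m Sx s.1 p.2)) *m (Ty b p.1 *m Tx a f))).
  apply: eq_bigr => f _; rewrite (reindex_inj (inv_inj (@barK n))) /=.
  apply: eq_bigr => r _; rewrite barK.
  under eq_bigr => s _ do rewrite exMxy mulmx_sumr mulmx_suml scaler_sumr.
  rewrite exchange_big /=; apply: eq_bigr => p _.
  rewrite mulmx_suml scaler_sumr; apply: eq_bigr => s _.
  by rewrite -scalemxAr -!scalemxAl !scalerA mulrC !mulmxA.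
transitivity (\sum_(u : label n * (label n * (label n * label n))) \sum_e
    (RD e.1 e.2 u.2.2.2 u.2.1 * RM u.2.2.1 u.2.2.2 (bar u.1) (bar u.2.1)) *:
      (Sx d e.2 *m Sy c e.1 *m (Ty b u.2.2.1 *m Tx a u.1))).
  rewrite -(pair_big xpredT xpredT (fun f v => \sum_e
      (RD e.1 e.2 v.2.2 v.1 * RM v.2.1 v.2.2 (bar f) (bar v.1)) *:
        (Sx d e.2 *m Sy c e.1 *m (Ty b v.2.1 *m Tx a f)))) /=.
  apply: eq_bigr => f _.
  rewrite -(pair_big xpredT xpredT (fun r p => \sum_e
      (RD e.1 e.2 p.2 r * RM p.1 p.2 (bar f) (bar r)) *:
        (Sx d e.2 *m Sy c e.1 *m (Ty b p.1 *m Tx a f)))) /=.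
  apply: eq_bigr => r _; apply: eq_bigr => p _.
  rewrite [X in _ *: (X *m _)](exD c d p.2 r) mulmx_suml scaler_sumr.
  by apply: eq_bigr => e _; rewrite -scalemxAl scalerA mulrC.
(* Only a regrouping: v collects the right colors of the four rows, and w the colors joining RD to
   RM. *)
transitivity (\sum_(v : label n * (label n * (label n * label n))) \sum_w
    (RD v.2.1 v.1 w.1 w.2 * RM v.2.2.2 w.1 (bar v.2.2.1) (bar w.2)) *:
      (Sx d v.1 *m Sy c v.2.1 *m (Ty b v.2.2.2 *m Tx a v.2.2.1))).
  rewrite !pair_big /=.
  rewrite (reindex (fun v : (label n * (label n * (label n * label n))) * (label n * label n) =>
     ((v.1.2.2.1, (v.2.2, (v.1.2.2.2, v.2.1))), (v.1.2.1, v.1.1)))) //.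
  by exists (fun u => ((u.2.2, (u.2.1, (u.1.1, u.1.2.2.1))), (u.1.2.2.2, u.1.2.1)))
    => -[[? [? [? ?]]] [? ?]].
rewrite -(pair_big xpredT xpredT (fun h v => \sum_w
    (RD v.1 h w.1 w.2 * RM v.2.2 w.1 (bar v.2.1) (bar w.2)) *:
      (Sx d h *m Sy c v.1 *m (Ty b v.2.2 *m Tx a v.2.1)))) /=.
apply: eq_bigr => h _.
rewrite -(pair_big xpredT xpredT (fun g e => \sum_w
    (RD g h w.1 w.2 * RM e.2 w.1 (bar e.1) (bar w.2)) *:
      (Sx d h *m Sy c g *m (Ty b e.2 *m Tx a e.1)))) /=.
apply: eq_bigr => g _; apply: eq_bigr => e _.
rewrite -scaler_suml; congr (_ *: _).
rewrite -(pair_big xpredT xpredT (fun m r =>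
  RD g h m r * RM e.2 m (bar e.1) (bar r))) /= -refl.
by rewrite pair_big.
Qed.
End Reflection.

(** * Rows of the lattice *)

Section FfunCons.
Variables (T : Type) (m : nat).

(** Columns are numbered from the right and levels from the bottom, so the added entry is the
    right-most column or the lowest level. *)
Definition fcons (x : T) (f : {ffun 'I_m -> T}) : {ffun 'I_m.+1 -> T} :=
  [ffun i => if unlift ord0 i is Some j then f j else x].

Lemma fcons0 x f : fcons x f ord0 = x.
Proof. by rewrite ffunE unlift_none. Qed.

Lemma fconsS x f j : fcons x f (lift ord0 j) = f j.
Proof. by rewrite ffunE liftK. Qed.

Lemma fcons_eta (f : {ffun 'I_m.+1 -> T}) :
  fcons (f ord0) [ffun j => f (lift ord0 j)] = f.
Proof.
by apply/ffunP => i; rewrite ffunE; case: unliftP => [j|] -> //; rewrite ffunE.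
Qed.
End FfunCons.

Lemma big_fcons (M : nmodType) (T : finType) m (F : {ffun 'I_m.+1 -> T} -> M) :
  \sum_f F f = \sum_x \sum_f F (fcons x f).
Proof.
rewrite pair_big /= (reindex (fun u => fcons u.1 u.2)) //.
exists (fun f : {ffun 'I_m.+1 -> T} => (f ord0, [ffun j => f (lift ord0 j)])) => /= [[x f]|f] _ /=.
  by congr pair; [rewrite fcons0|apply/ffunP => i; rewrite ffunE fconsS].
exact: fcons_eta.
Qed.

Lemma big_ffun0 (M : nmodType) (T : finType) (F : {ffun 'I_0 -> T} -> M) f :
  \sum_g F g = F f.
Proof.
rewrite (bigD1 f) //= big1 ?addr0 // => g /eqP[].
by apply/ffunP => -[].
Qed.

Section Rows.
Variables (R : comNzRingType) (n : nat).
Implicit Types (W : label n -> label n -> label n -> label n -> R).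

Definition vertical (L : nat) := {ffun 'I_L -> label n}.

Definition row_weight L W (l : label n) (t : vertical L) (r : label n)
    (b : vertical L) : R :=
  \sum_(h : {ffun 'I_L.+1 -> label n} | (h ord_max == l) && (h ord0 == r))
    \prod_(c < L) W (h (lift ord0 c)) (t c) (h (widen_ord (leqnSn L) c)) (b c).

Lemma row_weight0 W l (t : vertical 0) r b : row_weight W l t r b = (l == r)%:R.
Proof.
rewrite /row_weight big_mkcond big_fcons /=.
under eq_bigr => x _ do rewrite (big_ffun0 _ t) big_ord0.
rewrite (bigD1 r) //= big1 ?addr0 => [|x xr].
  rewrite (_ : ord_max = ord0) ?fcons0 ?eqxx ?andbT; last exact: val_inj.
  by rewrite eq_sym; case: ifP.
by rewrite fcons0 (negPf xr) andbF.
Qed.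

(** The right-most vertex is split off; p is the color on its left edge. *)
Lemma row_weightS L W l t0 (t : vertical L) r b0 b :
  row_weight W l (fcons t0 t) r (fcons b0 b)
  = \sum_p row_weight W l t p b * W p t0 r b0.
Proof.
rewrite /row_weight big_mkcond big_fcons (bigD1 r) //= [X in _ + X]big1 ?addr0; last first.
  by move=> x xr; rewrite big1 // => f _; rewrite fcons0 (negPf xr) andbF.
transitivity (\sum_(h : {ffun 'I_L.+1 -> label n} | h ord_max == l)
    W (h ord0) t0 r b0 *
    \prod_(c < L) W (h (lift ord0 c)) (t c) (h (widen_ord (leqnSn L) c)) (b c)).
  rewrite [RHS]big_mkcond; apply: eq_bigr => h _.
  rewrite fcons0 eqxx andbT (_ : ord_max = lift ord0 ord_max) ?fconsS; last exact: val_inj.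
  case: ifP => // _; rewrite big_ord_recl fconsS !fcons0.
  rewrite (_ : widen_ord _ ord0 = ord0) ?fcons0; last exact: val_inj.
  congr (_ * _); apply: eq_bigr => c _.
  rewrite (_ : widen_ord (leqnSn L.+1) (lift ord0 (c : 'I_L)) = lift ord0 (widen_ord (leqnSn L) c)) ?fconsS //.
  exact: val_inj.
rewrite (partition_big (fun h : {ffun 'I_L.+1 -> label n} => h ord0) xpredT) //=.
apply: eq_bigr => p _; rewrite mulr_suml.
by apply: eq_big => // h /andP[_ /eqP ->]; rewrite mulrC.
Qed.

(** Two rows glued along the vertical colors m, with W1 above W2, left colors u and right colors
    v. *)
Definition row_pair L W1 W2 (t s : vertical L) (u v : label n * label n) : R :=
  \sum_m row_weight W1 u.1 t v.1 m * row_weight W2 u.2 m v.2 s.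

Lemma row_pairS L W1 W2 t0 (t : vertical L) s0 s u v :
  row_pair W1 W2 (fcons t0 t) (fcons s0 s) u v
  = \sum_w row_pair W1 W2 t s u w *
           (\sum_m W1 w.1 t0 v.1 m * W2 w.2 m v.2 s0).
Proof.
rewrite /row_pair big_fcons.
transitivity (\sum_m0 \sum_m \sum_w
   (row_weight W1 u.1 t w.1 m * row_weight W2 u.2 m w.2 s) *
   (W1 w.1 t0 v.1 m0 * W2 w.2 m0 v.2 s0)).
  apply: eq_bigr => m0 _; apply: eq_bigr => m _.
  rewrite !row_weightS mulr_suml.
  rewrite -(pair_big xpredT xpredT (fun p p' =>
     row_weight W1 u.1 t p m * row_weight W2 u.2 m p' s *
     (W1 p t0 v.1 m0 * W2 p' m0 v.2 s0))) /=.
  apply: eq_bigr => p _; rewrite mulr_sumr; apply: eq_bigr => p' _; ring.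
under eq_bigr => m0 _ do rewrite exchange_big.
rewrite exchange_big; apply: eq_bigr => w _ /=.
rewrite exchange_big mulr_suml; apply: eq_bigr => m _ /=.
by rewrite -mulr_sumr.
Qed.

(** The train argument: the R-matrix is pushed through the columns one at a time. *)
Lemma ybe_row L X W1 W2 (t s : vertical L) u v : ybe X W1 W2 ->
  \sum_w X u.1 u.2 w.1 w.2 * row_pair W1 W2 t s w v
  = \sum_w row_pair W2 W1 t s u w * X w.1 w.2 v.1 v.2.
Proof.
move=> yb; elim: L t s u v => [|L IH] t s u v.
  (* Without columns a pair of rows is the identity, and both sides are X. *)
  have row0 W W' w w' : row_pair W W' t s w w' = (w == w')%:R.
    rewrite /row_pair (big_ffun0 _ t) !row_weight0 -natrM mulnb.
    by case: w w' => [? ?] [? ?].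
  under eq_bigr do rewrite row0 mulrC.
  under [RHS]eq_bigr do rewrite row0 eq_sym.
  by rewrite !sum_delta.
rewrite -(fcons_eta t) -(fcons_eta s).
move: (t ord0) (s ord0) [ffun j => t (lift ord0 j)] [ffun j => s (lift ord0 j)].
move=> t0 s0 {}t {}s.
under eq_bigr do rewrite row_pairS mulr_sumr.
under [RHS]eq_bigr do rewrite row_pairS mulr_suml.
rewrite exchange_big /=.
(* The induction hypothesis takes X through all columns but the right-most; [yb] takes it through
   that one. *)
transitivity (\sum_w' \sum_w row_pair W2 W1 t s u w * X w.1 w.2 w'.1 w'.2 *
    \sum_m W1 w'.1 t0 v.1 m * W2 w'.2 m v.2 s0).
  apply: eq_bigr => w' _; rewrite -mulr_suml -IH mulr_suml.
  by apply: eq_bigr => w _; rewrite mulrA.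
rewrite exchange_big [RHS]exchange_big /=; apply: eq_bigr => w _.
under eq_bigr do rewrite -mulrA.
under [RHS]eq_bigr do rewrite -mulrA.
rewrite -!mulr_sumr; congr (_ * _).
have := yb w.1 w.2 v.1 v.2 t0 s0.
by rewrite !pair_big.
Qed.

(* The row index is the bottom boundary and the column index the top one, so that
   matrix products list the rows of the lattice from bottom to top. *)
Definition row_mx L W (l r : label n) : 'M[R]_(#|{: vertical L}|) :=
  \matrix_(i, j) row_weight W l (enum_val j) r (enum_val i).

Lemma row_mx_mul L W W' (l r l' r' : label n) i j :
  (row_mx L W l r *m row_mx L W' l' r') i j
  = \sum_m row_weight W' l' (enum_val j) r' m * row_weight W l m r (enum_val i).
Proof.
rewrite !mxE (reindex (@enum_rank _)) /=; last first.
  by exists enum_val => ? _; [exact: enum_rankK|exact: enum_valK].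
by apply: eq_bigr => m _; rewrite !mxE enum_rankK mulrC.
Qed.

Lemma exchange_row L X W1 W2 : ybe X W1 W2 ->
  exchange X (row_mx L W1) (row_mx L W2).
Proof.
move=> yb a b c d; apply/matrixP => i j; rewrite !summxE.
under eq_bigr do rewrite mxE row_mx_mul.
under [RHS]eq_bigr do rewrite mxE row_mx_mul mulrC.
exact: (ybe_row (enum_val j) (enum_val i) (a, b) (c, d) yb).
Qed.

End Rows.

(** * Partition function as a matrix product *)

Lemma fcons_inord (T : Type) N (x : T) (f : {ffun 'I_N.+1 -> T}) k :
  (k <= N)%N -> fcons x f (inord k.+1) = f (inord k).
Proof.
move=> kN; rewrite (_ : inord k.+1 = lift ord0 (inord k)) ?fconsS //.
by apply: val_inj; rewrite /= !inordK.
Qed.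

(** The transfer matrix method, with levels taken two at a time: the middle level of each double row
    is summed inside its matrix. *)
Lemma big_path (R : comNzRingType) (T : finType) m (E : 'I_m -> T -> T -> T -> R)
    (b t : T) :
  \sum_(u : {ffun 'I_m.*2.+1 -> T} | (u ord0 == b) && (u ord_max == t))
    \prod_(k < m) E k (u (inord k.*2)) (u (inord k.*2.+1)) (u (inord k.*2.+2))
  = (\prod_(k < m)
       \matrix_(i, j) \sum_y E k (enum_val i) y (enum_val j))
      (enum_rank b) (enum_rank t).
Proof.
elim: m E b => [|m IH] E b.
  rewrite big_mkcond big_fcons big_ord0 mxE (inj_eq enum_rank_inj) /=.
  under eq_bigr do rewrite (big_ffun0 _ [ffun=> b]) big_ord0.
  rewrite (_ : ord_max = ord0); last exact: val_inj.
  under eq_bigr do rewrite fcons0.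
  rewrite (bigD1 b) //= eqxx big1 ?addr0 => [|x /negPf -> //].
  by rewrite /=; case: eqP.
rewrite big_ord_recl -mulmxE mxE.
transitivity (\sum_z \sum_y E ord0 b y z *
  \sum_(u : {ffun 'I_m.*2.+1 -> T} | (u ord0 == z) && (u ord_max == t))
    \prod_(k < m) E (lift ord0 k)
       (u (inord k.*2)) (u (inord k.*2.+1)) (u (inord k.*2.+2))); last first.
  rewrite (reindex (@enum_rank T)) /=; last first.
    by exists enum_val => ? _; [exact: enum_rankK|exact: enum_valK].
  by apply: eq_bigr => z _; rewrite mxE !enum_rankK -(IH (fun k => E (lift ord0 k))) mulr_suml.
rewrite big_mkcond big_fcons (bigD1 b) //= [X in _ + X]big1 ?addr0; last first.
  by move=> x xb; rewrite big1 // => f _; rewrite fcons0 (negPf xb).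
rewrite big_fcons [RHS]exchange_big /=; apply: eq_bigr => y _.
rewrite (partition_big (fun u : {ffun 'I_m.*2.+1 -> T} => u ord0) xpredT) //=.
apply: eq_bigr => z _; rewrite mulr_sumr [LHS]big_mkcond [RHS]big_mkcond /=.
apply: eq_bigr => u _.
rewrite (_ : ord_max = lift ord0 (lift ord0 ord_max)); last exact: val_inj.
rewrite !fconsS fcons0 eqxx /=.
case: eqP => //= uz; case: ifP => // _.
rewrite big_ord_recl /= -uz; congr (_ * _).
  have inord0 N : inord 0 = ord0 :> 'I_N.+1 by apply: val_inj; rewrite /= inordK.
  by rewrite !fcons_inord // !inord0 !fcons0.
apply: eq_bigr => k _; rewrite (_ : (bump 0 k).*2 = k.*2.+2)%N ?doubleS //.
have := ltn_ord k; rewrite -leq_double => km.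
by rewrite !(@fcons_inord _ m.*2.+1) ?(@fcons_inord _ m.*2) //; lia.
Qed.

Section Ice.
Variables (R : comNzRingType) (n L : nat) (lam : n.-tuple nat).
Variables (sigma tau : {perm label n}).
Implicit Types (G D : 'I_n -> label n -> label n -> label n -> label n -> R).

(** The weights are arbitrary, so that they may be rescaled and mapped to other rings. One delta
    symbol describes the cap because [bar] fixes the color +. *)
Definition ice_weight G D (s : state n L) : R :=
    (\prod_(r : ice_row n) \prod_(c < L) (if r.2 then G else D) r.1
       (left_edge s r c) (top_edge s r c) (right_edge s r c) (bottom_edge s r c)) *
    \prod_(k < n) (s.1 ((k, false), ord0) == bar (s.1 ((k, true), ord0)))%:R.

Definition ice G D : R :=
  \sum_(s : state n L | compatible lam sigma tau s) ice_weight G D s.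

Definition bottom_row : vertical n L := [ffun c => bottom_color lam tau c].
Definition top_row : vertical n L := [ffun=> plus n].

Definition pair_weight G D k (b m t : vertical n L) : R :=
  \sum_g row_weight (G k) (sigma (pos k)) t g m *
         row_weight (D k) (plus n) m (bar g) b.

Definition row_states := {ffun 'I_L.+1 -> label n}.

Definition row_prod W (h : row_states) (t b : vertical n L) : R :=
  \prod_(c < L) W (h (inord c.+1)) (t c) (h (inord c)) (b c).

Lemma row_weightE W l t r b :
  row_weight W l t r b
  = \sum_(h : row_states | (h ord_max == l) && (h ord0 == r)) row_prod W h t b.
Proof.
apply: eq_bigr => h _; apply: eq_bigr => c _.
by congr (W (h _) _ (h _) _); apply: val_inj; rewrite /= inordK // ltnS // ltnW.
Qed.

Lemma pair_weightE G D k b m t :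
  pair_weight G D k b m t = \sum_(h : row_states * row_states)
    if (h.1 ord_max == sigma (pos k)) && (h.2 ord_max == plus n) then
      row_prod (G k) h.1 t m * row_prod (D k) h.2 m b *
      (h.2 ord0 == bar (h.1 ord0))%:R
    else 0.
Proof.
rewrite -(pair_big xpredT xpredT (fun g d : row_states =>
   if (g ord_max == sigma (pos k)) && (d ord_max == plus n) then
      row_prod (G k) g t m * row_prod (D k) d m b *
      (d ord0 == bar (g ord0))%:R else 0)) /=.
rewrite (partition_big (fun g : row_states => g ord0) xpredT) //=.
apply: eq_bigr => x _; rewrite row_weightE row_weightE mulr_suml.
rewrite [LHS]big_mkcond [RHS]big_mkcond; apply: eq_bigr => g _.
rewrite andbC; case: eqP => //= ->.
case: eqP => [_|_]; last by rewrite big1.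
rewrite mulr_sumr big_mkcond; apply: eq_bigr => d _.
by case: eqP => //= _; case: eqP => _; rewrite ?(mulr1, mulr0).
Qed.

(** A state is read as a sequence u of vertical levels and a family f of horizontal colorings, one
    pair per double row. For fixed u the conditions on f are independent, so the sum over f is a
    product over the double rows. *)
Lemma ice_path G D :
  ice G D = \sum_(u : {ffun 'I_n.*2.+1 -> vertical n L}
                  | (u ord0 == bottom_row) && (u ord_max == top_row))
    \prod_(k < n) pair_weight G D k (u (inord k.*2)) (u (inord k.*2.+1))
                    (u (inord k.*2.+2)).
Proof.
rewrite /ice big_mkcond; pose F (s : state n L) :=
  if compatible lam sigma tau s then ice_weight G D s else 0.
have -> : \sum_s (if compatible lam sigma tau s then ice_weight G D s else 0) = \sum_h \sum_v F (h, v).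
  by rewrite pair_bigA; apply: eq_bigr => -[].
rewrite exchange_big /= [RHS]big_mkcond /=.
rewrite (reindex (fun u : {ffun 'I_n.*2.+1 -> vertical n L} =>
   [ffun x => u x.1 x.2] : vcolors n L)) /=; last first.
  exists (fun v : vcolors n L => [ffun m => [ffun c => v (m, c)]]) => u _.
    by apply/ffunP => m; apply/ffunP => c; rewrite !ffunE.
  by apply/ffunP => -[m c]; rewrite !ffunE.
apply: eq_bigr => u _.
rewrite (reindex (fun f : {ffun 'I_n -> row_states * row_states} =>
   [ffun x => (if x.1.2 then (f x.1.1).1 else (f x.1.1).2) x.2] : hcolors n L)) /=;
  last first.
  exists (fun h : hcolors n L => [ffun k =>
    ([ffun e => h ((k, true), e)], [ffun e => h ((k, false), e)])]) => f _.
    apply/ffunP => k; rewrite ffunE [RHS]surjective_pairing.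
    by congr pair; apply/ffunP => e; rewrite !ffunE.
  by apply/ffunP => -[[k []] e]; rewrite !ffunE.
transitivity (\sum_(f : {ffun 'I_n -> row_states * row_states})
    if (u ord0 == bottom_row) && (u ord_max == top_row) then
      \prod_k (if ((f k).1 ord_max == sigma (pos k)) && ((f k).2 ord_max == plus n) then
        row_prod (G k) (f k).1 (u (inord k.*2.+2)) (u (inord k.*2.+1)) *
        row_prod (D k) (f k).2 (u (inord k.*2.+1)) (u (inord k.*2)) *
       ((f k).2 ord0 == bar ((f k).1 ord0))%:R else 0) else 0); last first.
  case: ifP => _; last by rewrite big1.
  by under [RHS]eq_bigr do rewrite pair_weightE; rewrite bigA_distr_bigA.
apply: eq_bigr => f _; rewrite /F.
set h := [ffun x => _]; set v := [ffun x => _].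
have -> : compatible lam sigma tau (h, v) =
  [forall k, ((f k).1 ord_max == sigma (pos k)) && ((f k).2 ord_max == plus n)] &&
  ((u ord0 == bottom_row) && (u ord_max == top_row)).
  rewrite /compatible /= [LHS]andbA; congr (_ && _).
    apply/idP/forallP => [/andP[/forallP hT /forallP hF] k|hk].
      by have := hT k; have := hF k; rewrite !ffunE /= => -> ->.
    by apply/andP; split; apply/forallP => k; have /andP[] := hk k; rewrite !ffunE.
  rewrite andbC; congr (_ && _); apply/forallP/eqP => [vE|vE c].
  - by apply/ffunP => c; have := vE c; rewrite !ffunE /= => /eqP.
  - by rewrite !ffunE /= vE ffunE.
  - by apply/ffunP => c; have := vE c; rewrite !ffunE /= => /eqP.
  - by rewrite !ffunE /= vE ffunE.
(* If a left boundary color is wrong, the state is excluded on one side and has a zero factor on the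
   other. *)
case: forallP => [fP|/forallP]; last first.
  rewrite negb_forall => /existsP[k /negPf fk] /=; case: ifP => // _.
  by rewrite (bigD1 k) //= fk mul0r.
rewrite andTb; case: ifP => //= _.
rewrite /ice_weight /=.
under [RHS]eq_bigr do rewrite fP.
rewrite big_split /=; congr (_ * _); last first.
  by apply: eq_bigr => k _; rewrite !ffunE.
transitivity (\prod_k \prod_b \prod_(c < L) (if b then G else D) k
   (left_edge (h, v) (k, b) c) (top_edge (h, v) (k, b) c)
   (right_edge (h, v) (k, b) c) (bottom_edge (h, v) (k, b) c)).
  by rewrite [RHS]pair_bigA; apply: eq_bigr => -[].
apply: eq_bigr => k _; rewrite big_bool /=.
congr (_ * _); apply: eq_bigr => c _.
  by rewrite /left_edge /top_edge /right_edge /bottom_edge /level /= !ffunE /= addn1.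
by rewrite /left_edge /top_edge /right_edge /bottom_edge /level /= !ffunE /= addn0.
Qed.
End Ice.

Section IceMx.
Variables (R : comNzRingType) (n L : nat) (lam : n.-tuple nat).
Variables (sigma tau : {perm label n}).
Implicit Types (G D : 'I_n -> label n -> label n -> label n -> label n -> R).

Lemma ice_mx G D :
  ice L lam sigma tau G D
  = (\prod_(k < n) double_row (row_mx L (D k)) (row_mx L (G k))
                              (sigma (pos k)) (plus n))
      (enum_rank (bottom_row L lam tau)) (enum_rank (top_row n L)).
Proof.
rewrite ice_path big_path.
rewrite (eq_bigr (fun k => double_row (row_mx L (D k)) (row_mx L (G k))
                              (sigma (pos k)) (plus n))) // => k _.
apply/matrixP => i j; rewrite mxE summxE exchange_big /=.
by apply: eq_bigr => g _; rewrite row_mx_mul.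
Qed.

Lemma ice_rmorph (R' : comNzRingType) (f : {rmorphism R -> R'}) G D :
  f (ice L lam sigma tau G D)
  = ice L lam sigma tau (fun k l t r b => f (G k l t r b))
      (fun k l t r b => f (D k l t r b)).
Proof.
rewrite rmorph_sum; apply: eq_bigr => s _; rewrite rmorphM !rmorph_prod.
congr (_ * _); last by apply: eq_bigr => k _; rewrite rmorph_nat.
by apply: eq_bigr => -[k []] _; rewrite rmorph_prod.
Qed.

Lemma eq_ice G G' D D' :
  (forall k l t r b, G k l t r b = G' k l t r b) ->
  (forall k l t r b, D k l t r b = D' k l t r b) ->
  ice L lam sigma tau G D = ice L lam sigma tau G' D'.
Proof.
move=> eG eD; apply: eq_bigr => s _; congr (_ * _).
by apply: eq_bigr => -[k []] _; apply: eq_bigr => c _ /=; rewrite ?eG ?eD.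
Qed.

End IceMx.

(** * Exchange of two adjacent double rows *)

Lemma prod_adjacent (A : pzRingType) n (F : 'I_n.+1 -> A) (i j : 'I_n.+1) :
  j = i.+1 :> nat ->
  \prod_k F k = (\prod_(0 <= m < i) F (inord m)) * (F i * F j) *
                (\prod_(i.+2 <= m < n.+1) F (inord m)).
Proof.
move=> ij; have -> : \prod_k F k = \prod_(0 <= m < n.+1) F (inord m).
  by rewrite big_mkord; apply: eq_bigr => k _; rewrite inord_val.
have jn := ltn_ord j; rewrite ij in jn.
rewrite (@big_cat_nat _ _ _ i) //=; last exact: ltnW (ltn_ord i).
rewrite (big_ltn (ltn_ord i)) (big_ltn jn).
by rewrite inord_val -ij inord_val !mulrA.
Qed.

(** The matrices need not commute, but i and j are adjacent and all other factors agree, so they can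
    be pulled out on both sides of the local relation. *)
Lemma prod_adjacent_linear (R : comNzRingType) k n (F1 F2 F3 : 'I_n -> 'M[R]_k)
    (i j : 'I_n) (c1 c2 c3 : R) :
  j = i.+1 :> nat ->
  (forall m, m != i -> m != j -> F1 m = F3 m) ->
  (forall m, m != i -> m != j -> F2 m = F3 m) ->
  c1 *: (F1 i *m F1 j) + c2 *: (F2 i *m F2 j) = c3 *: (F3 i *m F3 j) ->
  c1 *: (\prod_m F1 m) + c2 *: (\prod_m F2 m) = c3 *: (\prod_m F3 m).
Proof.
case: n F1 F2 F3 i j => [|n] F1 F2 F3 i j; first by case: i.
move=> ij e1 e2 e3; rewrite !(prod_adjacent _ ij).
have agree (F : 'I_n.+1 -> 'M[R]_k) : (forall m, m != i -> m != j -> F m = F3 m) ->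
    (\prod_(0 <= m < i) F (inord m) = \prod_(0 <= m < i) F3 (inord m)) *
    (\prod_(i.+2 <= m < n.+1) F (inord m) = \prod_(i.+2 <= m < n.+1) F3 (inord m)).
  move=> e; split; apply: eq_big_nat => m /andP[m1 m2]; apply: e;
    rewrite -val_eqE /= inordK ?ij; have := ltn_ord i; lia.
rewrite !(agree F1 e1) !(agree F2 e2).
have push c (P M Q : 'M[R]_k) : c *: (P *m M *m Q) = P *m (c *: M) *m Q.
  by rewrite scalemxAl scalemxAr.
by rewrite -!mulmxE !push -mulmxDl -mulmxDr e3.
Qed.

Section Local.
Variables (R : comNzRingType) (n : nat).

(** This is q to the power of the indicator of u > 0. *)
Definition sign_factor (q : R) (u : label n) : R := if (plus n < u)%N then q else 1.

(** Exchanging the colors would force u to be +, so both lines keep their colors. *)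
Lemma Rmixed_plus (q x y : R) (u c d : label n) : u != plus n ->
  Rmixed q x y u (plus n) c d
  = (c == plus n)%:R * ((d == u)%:R * (mixed q x y * sign_factor q u)).
Proof.
move=> u0; rewrite /Rmixed /cross (eq_sym (plus n) u) (negPf u0) mulr0 mul0r addr0.
rewrite (eq_sym (plus n) c); case: (c =P plus n) => [->|_]; last by rewrite mulr0 !mul0r.
rewrite mulr1 mul1r /cmp /sign_factor; congr (_ * _).
by case: ltngtP u0 => [_ _|_ _|/val_inj -> /eqP] //; rewrite ?mulr1 // mulrC.
Qed.

Lemma Rdelta_plus (q x y : R) (c d : label n) :
  Rdelta q x y (plus n) (plus n) c d
  = (c == plus n)%:R * ((d == plus n)%:R * (1 - (q + 1) * x + q * x * y)).
Proof.
rewrite /Rdelta /cross !(eq_sym (plus n)) /cmp.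
case: eqP => [->|_]; case: eqP => [->|_]; rewrite ?ltnn; rewrite /= ?(mulr0n, mulr1n); ring.
Qed.

Lemma double_row_exchange L (q x y : R) (a b : label n) :
  (a < b)%N -> a != plus n -> b != plus n ->
  let D z u := double_row (row_mx L (deltaw q z)) (row_mx L (gammaw q z)) u (plus n) in
  (mixed q x y * ((y - x) * sign_factor q b)) *: (D x b *m D y a)
  + (mixed q x y * ((1 - q * x) * (1 - y) * sign_factor q a)) *: (D x a *m D y b)
  = (mixed q x y * ((1 - (q + 1) * x + q * x * y) * sign_factor q a)) *: (D y a *m D x b).
Proof.
move=> ab a0 b0 D.
(* A crossing with a single possible outcome reduces the sum to one term. *)
have sum_plus (u w : label n) (X : label n -> label n -> R) c F :
    (forall c' d', X c' d' = (c' == w)%:R * ((d' == u)%:R * c)) ->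
    \sum_s X s.1 s.2 *: F s.1 s.2 = c *: F w u :> 'M[R]_#|{: vertical n L}|.
  move=> XE; rewrite -(pair_bigA _ (fun c d => X c d *: F c d)) /=.
  under eq_bigr => c' _ do under eq_bigr => d' _ do rewrite XE -2!scalerA.
  by under eq_bigr => c' _ do rewrite -scaler_sumr sum_deltaZ; rewrite sum_deltaZ.
have exM : exchange (@Rmixed R n q x y) (row_mx L (deltaw q x)) (row_mx L (gammaw q y)).
  have := exchange_row L (@ybe_mixed R n q y x) => ex a' b' c d.
  under eq_bigr do rewrite RmixedC.
  by under [RHS]eq_bigr do rewrite RmixedC.
pose DD z (u d : label n) :=
  double_row (row_mx L (deltaw q z)) (row_mx L (gammaw q z)) u d.
have refl : \sum_r Rgamma q x y b a r.1 r.2 *: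
    (\sum_s Rmixed q x y r.2 (plus n) s.1 s.2 *: (DD x s.2 (plus n) *m DD y r.1 s.1))
  = \sum_r Rdelta q x y (plus n) (plus n) r.1 r.2 *:
    (\sum_s Rmixed q x y a r.1 s.1 s.2 *: (DD y s.2 r.2 *m DD x b s.1)).
  exact: (reflection_equation b a (plus n) (plus n)
    (exchange_row L (ybe_gamma q x y)) (exchange_row L (ybe_delta q x y))
    (exchange_row L (ybe_mixed q x y)) exM (cap_reflection q x y)).
move: refl.
rewrite (sum_plus _ _ _ _ (fun r1 r2 =>
    \sum_s Rmixed q x y a r1 s.1 s.2 *: (DD y s.2 r2 *m DD x b s.1))
  (Rdelta_plus q x y)).
rewrite (sum_plus _ _ _ _ (fun s1 s2 => DD y s2 (plus n) *m DD x b s1)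
   (fun c d => Rmixed_plus q x y c d a0)).
rewrite -(pair_bigA _ (fun c d => Rgamma q x y b a c d *:
  (\sum_s Rmixed q x y d (plus n) s.1 s.2 *: (DD x s.2 (plus n) *m DD y c s.1)))) /=.
rewrite exchange_big /= sum_crossZ.
rewrite !(sum_plus _ _ _ _ (fun s1 s2 => DD x s2 (plus n) *m DD y _ s1)
   (fun c d => Rmixed_plus q x y c d _)) //.
(* As b > a, the crossing of b with a has weight y - x when the colors are kept and (1 - q x)(1 - y)
   when they are exchanged. *)
rewrite /cmp ltnNge (ltnW ab) /= ab !scalerA => E.
by rewrite 3!(mulrCA (mixed q x y)).
Qed.
End Local.

(** * The recursion for weights with cleared denominators *)

Section Homogeneous.
Variables (n L : nat) (lam : n.-tuple nat) (tau : {perm label n}).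
Implicit Types (sigma : {perm label n}).

(** These weights make sense over any commutative ring, so z may consist of polynomials. *)
Definition hice (R : comNzRingType) sigma (q : R) (z : 'I_n -> R) : R :=
  ice L lam sigma tau (fun k => gammaw q (z k)) (fun k => deltaw q (z k)).

Definition switch (T : Type) (i j : 'I_n) (f g : 'I_n -> T) : Prop :=
  [/\ g i = f j, g j = f i & forall k, k != i -> k != j -> g k = f k].

Lemma hice_exchange_mixed (R : comNzRingType) sigma sigma' (q : R) z z' (i j : 'I_n) :
  j = i.+1 :> nat -> (forall k, sigma (pos k) != plus n) ->
  (sigma (pos i) < sigma (pos j))%N ->
  switch i j (fun k => sigma (pos k)) (fun k => sigma' (pos k)) ->
  switch i j z z' ->
  mixed q (z i) (z j) * ((z j - z i) * sign_factor q (sigma (pos j))) *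
    hice sigma' q z
  + mixed q (z i) (z j) * ((1 - q * z i) * (1 - z j) * sign_factor q (sigma (pos i))) *
    hice sigma q z
  = mixed q (z i) (z j) * ((1 - (q + 1) * z i + q * z i * z j) *
      sign_factor q (sigma (pos i))) * hice sigma q z'.
Proof.
move=> ij s0 sij [s'i s'j s'E] [z'i z'j z'E]; rewrite /hice !ice_mx.
pose M (s : {perm label n}) (y : 'I_n -> R) k := double_row (row_mx L (deltaw q (y k)))
  (row_mx L (gammaw q (y k))) (s (pos k)) (plus n).
have e1 k : k != i -> k != j -> M sigma' z k = M sigma z' k.
  by move=> ki kj; rewrite /M s'E // z'E.
have e2 k : k != i -> k != j -> M sigma z k = M sigma z' k.
  by move=> ki kj; rewrite /M z'E.
have e3 := double_row_exchange L q (z i) (z j) sij (s0 i) (s0 j).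
have Mi : M sigma' z i *m M sigma' z j = M sigma (fun=> z i) j *m M sigma (fun=> z j) i.
  by rewrite /M s'i s'j.
have Mj : M sigma z' i *m M sigma z' j = M sigma (fun=> z j) i *m M sigma (fun=> z i) j.
  by rewrite /M z'i z'j.
rewrite /= -Mi -Mj in e3.
(* The bottom and top boundary colors select one entry of the matrix identity. *)
have /matrixP := prod_adjacent_linear ij e1 e2 e3.
move=> /(_ (enum_rank (bottom_row L lam tau)) (enum_rank (top_row n L))).
by rewrite !mxE.
Qed.

Lemma rmorph_cmp (R R' : comNzRingType) (f : {rmorphism R -> R'}) (u v : label n) x y w :
  f (cmp u v x y w) = cmp u v (f x) (f y) (f w).
Proof. by rewrite /cmp; case: ifP => // _; case: ifP. Qed.

Lemma rmorph_hice (R R' : comNzRingType) (f : {rmorphism R -> R'}) sigma q z :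
  f (hice sigma q z) = hice sigma (f q) (f \o z).
Proof.
rewrite /hice ice_rmorph; apply: eq_ice => k l t r b;
  rewrite /gammaw /deltaw /cross rmorphD !rmorphM !rmorph_nat !rmorph_cmp;
  by rewrite ?(rmorphB, rmorphM, rmorphD, rmorph1, rmorph0).
Qed.

(** At particular values in F the factor [mixed] may vanish, so it is cancelled over the domain of
    polynomials in one variable X. *)
Lemma hice_exchange (F : fieldType) sigma sigma' (q : F) z z' (i j : 'I_n) :
  j = i.+1 :> nat -> (forall k, sigma (pos k) != plus n) ->
  (sigma (pos i) < sigma (pos j))%N ->
  switch i j (fun k => sigma (pos k)) (fun k => sigma' (pos k)) ->
  switch i j z z' ->
  (z j - z i) * sign_factor q (sigma (pos j)) * hice sigma' q z
  + (1 - q * z i) * (1 - z j) * sign_factor q (sigma (pos i)) * hice sigma q z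
  = (1 - (q + 1) * z i + q * z i * z j) * sign_factor q (sigma (pos i)) *
    hice sigma q z'.
Proof.
move=> ij s0 sij ss [z'i z'j z'E].
(* The spectral parameters z_k X make the factor [mixed] nonzero, as its constant
   term is 1; it is cancelled before specializing X to 1. *)
have [Z ZE] : exists Z : ('I_n -> F) -> 'I_n -> {poly F},
    forall y k, Z y k = (y k)%:P * 'X by exists (fun y k => (y k)%:P * 'X).
have sZ : switch i j (Z z) (Z z').
  by split=> [||k ki kj]; rewrite !ZE ?z'i ?z'j ?z'E.
have := hice_exchange_mixed q%:P ij s0 sij ss sZ.
rewrite -!mulrA -mulrDr => /(mulfI _) E.
have m0 : mixed q%:P (Z z i) (Z z j) != 0.
  apply/eqP => /(congr1 (horner_eval 0)); rewrite rmorph0.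
  have Z0 k : horner_eval 0 (Z z k) = 0 by rewrite /horner_eval ZE hornerM hornerX mulr0.
  rewrite /mixed rmorphD rmorphB !rmorphM rmorph1 !rmorphD /= !Z0 => /eqP.
  by rewrite addr0 !mulr0 subr0 add0r oner_eq0.
have evZ sigma0 (y : 'I_n -> F) :
    horner_eval 1 (hice sigma0 q%:P (Z y)) = hice sigma0 q y.
  rewrite rmorph_hice; apply: eq_ice => k l t r b;
    by rewrite /= /horner_eval ZE hornerM !hornerC hornerX mulr1.
have evS u : horner_eval 1 (sign_factor q%:P u) = sign_factor q u.
  by rewrite /sign_factor; case: ifP => _; rewrite /horner_eval !hornerE.
have evz k : horner_eval 1 (Z z k) = z k by rewrite /horner_eval ZE !hornerE.
have evq : horner_eval 1 q%:P = q by rewrite /horner_eval !hornerE.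
have := congr1 (horner_eval 1) (E m0).
by rewrite !(rmorphD, rmorphN, rmorphM, rmorph1) /= !evZ !evS !evz !evq.
Qed.
End Homogeneous.

(** * Return to the stochastic weights *)

Section Field.
Variables (F : fieldType) (n : nat).
Implicit Types (l t r b : label n) (q x : F).

Lemma gammawE q x l t r b : gammaw q x l t r b = gamma_weight q x l t r b.
Proof.
rewrite /gammaw /cross /cmp /gamma_weight ![l == _]eq_sym ![t == r]eq_sym ![t == b]eq_sym.
case: (ltngtP l t) => [lt|tl|/val_inj <-];
  case: (r =P l) => rl; case: (b =P t) => bt; case: (r =P t) => rt;
  case: (b =P l) => bl; case: (t =P l) => tl'; case: (r =P b) => rb;
  try (by []); subst; rewrite ?ltnn ?eqxx //= ?(mulr0n, mulr1n); try ring; by [].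
Qed.

Lemma deltawE q x l t r b : q != 0 -> x != 0 ->
  deltaw q x l t r b = q * x * delta_weight q x l t r b.
Proof.
move=> q0 x0.
have e1 : q * ((q + 1) * x - 1) = q * x * delta_param q x by rewrite /delta_param; field.
have e2 : (q + 1) * x - 1 = q * x * (q^-1 * delta_param q x).
  by rewrite /delta_param; field; rewrite q0 x0.
have e3 : 1 - x = q * x * (1 - q^-1 * delta_param q x).
  by rewrite /delta_param; field; rewrite q0 x0.
have e4 : q * (1 - q * x) = q * x * (1 - delta_param q x) by rewrite /delta_param; field.
rewrite /deltaw /cross /cmp /delta_weight e1 e2 e3 e4; move: (delta_param q x) => d.
rewrite ![t == _]eq_sym ![r == b]eq_sym.
case: (ltngtP r t) => [rt|rt|/val_inj ->];
  try (have ne : (r == t) = false by apply/negbTE; rewrite -val_eqE neq_ltn rt ?orbT);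
  try (have := ltnW rt; rewrite leqNgt => /negbTE tr);
  case: (l =P r) => lr; case: (b =P t) => bt; case: (l =P t) => lt;
  case: (b =P r) => br; try (by []); subst;
  try (by rewrite ltnn in rt);
  rewrite ?ltnn ?eqxx ?andbF ?andbT /= ?(mulr0n, mulr1n);
  by try rewrite ?ne ?rt ?tr /=; ring.
Qed.

Lemma cap_weightE (u v : label n) : cap_weight F u v = (v == bar u)%:R.
Proof.
have bar_plus : bar (plus n) = plus n.
  by apply: val_inj; rewrite /= inordK; lia.
rewrite /cap_weight; case: (u =P plus n) => [->|_] /=; last by case: eqP.
by rewrite bar_plus; case: eqP.
Qed.

(** Clearing denominators multiplies each of the L Delta vertices with parameter z_k by q z_k. *)
Lemma hiceE L (lam : n.-tuple nat) (sigma tau : {perm label n}) q (z : 'I_n -> F) :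
  q != 0 -> (forall k, z k != 0) ->
  hice L lam tau sigma q z
  = (\prod_k (q * z k) ^+ L) * partition_function L lam sigma tau q z.
Proof.
move=> q0 z0; rewrite /hice /ice /partition_function mulr_sumr.
apply: eq_bigr => s _; rewrite /ice_weight /state_weight mulrA; congr (_ * _); last first.
  by apply: eq_bigr => k _; rewrite cap_weightE.
transitivity (\prod_(r : ice_row n) ((if r.2 then 1 else (q * z r.1) ^+ L) *
    \prod_(c < L) vertex_weight q z s r c)).
  apply: eq_bigr => -[k []] _ /=.
    by rewrite mul1r; apply: eq_bigr => c _; rewrite gammawE.
  rewrite -[L in _ ^+ L]card_ord -prodr_const -big_split /=.
  by apply: eq_bigr => c _; rewrite deltawE.
rewrite big_split /=; congr (_ * _).
transitivity (\prod_k \prod_b (if b then 1 else (q * z k) ^+ L)).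
  by rewrite pair_bigA.
by apply: eq_bigr => k _; rewrite big_bool /= mul1r.
Qed.
End Field.

Theorem theorem3p4 (F : fieldType) (n L : nat) (lam : n.-tuple nat)
    (sigma tau : {perm label n}) (q : F) (z : 'I_n -> F) (i j : 'I_n)
    (hsigma : sigma \in hyperoct n) (htau : tau \in hyperoct n)
    (hlam : sorted geq lam) (hL : (head 0 lam + n <= L)%N)
    (hij : j = i.+1 :> nat)
    (hasc : (sigma (pos i) < sigma (pos j))%N)
    (hq : q != 0) (hz : forall k, z k != 0) (hzij : z i != z j) :
  let A := (1 - z j) * (1 - q * z i) / (z j - z i) in
  let B := (1 - (q + 1) * z i + q * z i * z j) / (z j - z i) in
  q ^ ((plus n < sigma (pos j))%N%:Z - (plus n < sigma (pos i))%N%:Z)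
    * partition_function L lam (mulB sigma (transB i j)) tau q z
  = - A * partition_function L lam sigma tau q z
    + B * partition_function L lam sigma tau q (z \o tperm i j).
Proof.
have posE (k : 'I_n) : pos k = (n + k.+1)%N :> nat.
  by rewrite /pos inordK //; have := ltn_ord k; lia.
have plusE : plus n = n :> nat by rewrite /plus inordK //; lia.
have pos_inj : injective (@pos n).
  by move=> k k' /(congr1 val); rewrite /= !posE => /addnI [] /val_inj.
have pos_plus k : pos k != plus n by rewrite -val_eqE /= posE plusE; lia.
have pos_bar (k k' : 'I_n) : pos k != bar (pos k').
  by rewrite -val_eqE /= !posE; lia.
have sigma_plus k : sigma (pos k) != plus n.
  move: hsigma; rewrite inE => /andP[/perm_closed sT _].
  by have := sT (pos k); rewrite !inE pos_plus.
(* The second transposition of s_i moves only negative labels and does not affect [pos k]. *)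
have transBE k : transB i j (pos k) = pos (tperm i j k).
  by rewrite permM -(inj_tperm _ _ _ pos_inj) [LHS]tpermD // eq_sym pos_bar.
have switch_sigma : switch i j (fun k => sigma (pos k))
    (fun k => mulB sigma (transB i j) (pos k)).
  by split=> [||k ki kj]; rewrite /mulB permM transBE ?tpermL ?tpermR ?tpermD // eq_sym.
have switch_z : switch i j z (z \o tperm i j).
  by split=> [||k ki kj]; rewrite /= ?tpermL ?tpermR ?tpermD // eq_sym.
have := hice_exchange L lam tau q hij sigma_plus hasc switch_sigma switch_z.
rewrite !hiceE // => [|k]; last exact: hz.
(* The normalization is symmetric in z, so all three partition functions share the factor C. *)
have -> : \prod_k (q * (z \o tperm i j) k) ^+ L = \prod_k (q * z k) ^+ L.
  by rewrite [RHS](reindex_inj (@perm_inj _ (tperm i j))).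
set C := \prod_k _; have C0 : C != 0.
  by apply/prodf_neq0 => k _; rewrite expf_neq0 // mulf_neq0.
set P' := partition_function _ _ (mulB _ _) _ _ _.
set P := partition_function _ _ _ _ _ z; set P'' := partition_function _ _ _ _ _ _.
move=> E A B; rewrite {}/A {}/B.
have d0 : z j - z i != 0 by rewrite subr_eq0 eq_sym.
have s0 : sign_factor q (sigma (pos i)) != 0.
  by rewrite /sign_factor; case: ifP; rewrite ?oner_eq0.
have -> : q ^ ((plus n < sigma (pos j))%N%:Z - (plus n < sigma (pos i))%N%:Z)
    = sign_factor q (sigma (pos j)) / sign_factor q (sigma (pos i)).
  by rewrite /sign_factor; case: ifP => _; case: ifP => _;
    rewrite ?subr0 ?sub0r ?subrr ?divr1 ?divff ?mul1r //= ?expr1z ?exprN1.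
(* Multiplying by C, by the sign factor of sigma(i) and by z_j - z_i clears all denominators and
   leads back to E. *)
apply: (mulfI (mulf_neq0 (mulf_neq0 C0 s0) d0)).
transitivity ((z j - z i) * sign_factor q (sigma (pos j)) * (C * P')).
  by field.
rewrite (canRL (addrK _) E).
by field.
Qed.
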